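(* Let $n,T\in\mathbb{N}$ with $n\ge1$, $T\ge 2$, and let $z_1,\ldots,z_{n+1}$ be nonnegative reals with $z_1+\cdots+z_{n+1}=1$. Let $M$ be the transition matrix of the doubly enriched chain on $\tilde{\mathcal{T}}_n^T$ described in the context. Then the eigenvalues of $M$ are $1$, with multiplicity $1$, and $0$, with multiplicity $(n+1)^{n(T-1)}-1$.
   Context: $\tilde{\mathcal{T}}_n^T$ is the set of $(T-1)\times n$ matrices with entries in $\{1,\ldots,n+1\}$ (there are $(n+1)^{n(T-1)}$ of them). The transition probability from $A$ to $N$ is $\prod_{i=1}^{T-1}z_{N_{i,1}}$ if $N_{k,l}=A_{k,l-1}$ for all $k\in\{1,\ldots,T-1\}$ and $l\in\{2,\ldots,n\}$, and $0$ otherwise (the last column is deleted, the others shifted right, and a new first column is chosen with independent entries distributed according to $(z_1,\ldots,z_{n+1})$). *)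

(* Defs.v *)
From mathcomp Require Import all_boot all_order all_algebra.
From mathcomp Require Import complex reals.

Set Implicit Arguments.
Unset Strict Implicit.
Unset Printing Implicit Defensive.

Import Order.TTheory GRing.Theory Num.Theory.
Local Open Scope ring_scope.

(* Letters, rows and columns are numbered from 0: the letter i of {1,...,n+1} *)
(* is the ordinal i - 1 in 'I_n.+1, and the first column is column 0.         *)
Definition dstate (n T : nat) := 'M['I_n.+1]_(T - 1, n).

Definition shifted (n T : nat) (A N : dstate n T) : bool :=
  [forall k : 'I_(T - 1), forall l : 'I_n, forall l' : 'I_n,
     (l == l'.+1 :> nat) ==> (N k l == A k l')].

Definition trans_prob (R : realType) (n T : nat) (hn : (1 <= n)%N)
    (z : 'I_n.+1 -> R) (A N : dstate n T) : R :=
  if shifted A N then \prod_(i < T - 1) z (N i (Ordinal hn)) else 0.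

Definition trans_mx (R : realType) (n T : nat) (hn : (1 <= n)%N)
    (z : 'I_n.+1 -> R) : 'M[R]_(#|{: dstate n T}|) :=
  \matrix_(a, b) trans_prob hn z (enum_val a) (enum_val b).

Definition alg_mult (F : fieldType) (m : nat) (A : 'M[F]_m) (a : F) : nat :=
  mup a (char_poly A).

(* Main.v *)
Require Import Defs.
From mathcomp Require Import all_boot all_order all_algebra.
From mathcomp Require Import complex reals.

Set Implicit Arguments.
Unset Strict Implicit.
Unset Printing Implicit Defensive.

Import Order.TTheory GRing.Theory Num.Theory.
Local Open Scope ring_scope.

(** Inserting a new first column turns two states that agree on their first [k]
    columns into states that agree on their first [k.+1] columns. Hence, if
    [M G = a G] with [a != 0], a function [G] that depends only on the first
    [k.+1] columns depends only on the first [k], so [G] is constant and [a = 1]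
    because [M] is stochastic. The spectrum is thus contained in [{0, 1}], and
    the multiplicity of [1] is the trace of [M]. By the same contraction,
    inserting a given column fixes exactly one state, so the trace is the sum of
    the probabilities of all columns, that is [1]. *)

Lemma eigenvalue_tr (F : fieldType) (m : nat) (A : 'M[F]_m) :
  eigenvalue A^T =1 eigenvalue A.
Proof.
move=> a; rewrite /eigenvalue /eigenspace !kermx_eq0 !row_free_unit -unitmx_tr.
by rewrite linearB /= trmxK tr_scalar_mx.
Qed.

Lemma size_char_poly_roots (R : nzRingType) (m : nat) (A : 'M[R]_m)
    (rs : seq R) :
  char_poly A = \prod_(a <- rs) ('X - a%:P) -> size rs = m.
Proof.
by move=> charA; have := size_char_poly A; rewrite charA size_prod_XsubC => -[].
Qed.

Lemma mxtrace_sum_roots (R : comNzRingType) (m : nat) (A : 'M[R]_m)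
    (rs : seq R) :
  char_poly A = \prod_(a <- rs) ('X - a%:P) -> \tr A = \sum_(a <- rs) a.
Proof.
move=> charA; have size_rs := size_char_poly_roots charA.
case: m A charA size_rs => [|m] A charA size_rs.
  by rewrite (size0nil size_rs) big_nil /mxtrace big_ord0.
apply: oppr_inj; rewrite -char_poly_trace // charA -size_rs.
by rewrite coefPn_prod_XsubC ?size_rs.
Qed.

Lemma perm_nseq_pred2 (T : eqType) (x y : T) (s : seq T) :
  {subset s <= pred2 x y} ->
  perm_eq s (nseq (count_mem x s) x ++ nseq (size s - count_mem x s) y).
Proof.
move=> s_xy; rewrite -(perm_filterC (pred1 x)) perm_sym.
have -> : nseq (count_mem x s) x = filter (pred1 x) s.
  by rewrite -size_filter; apply/esym/all_pred1P/filter_all.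
rewrite -(count_predC (pred1 x) s) addKn -[count (predC _) s]size_filter.
suff /all_pred1P <- : all (pred1 y) (filter (predC (pred1 x)) s) by [].
apply/allP=> z; rewrite mem_filter => /andP[/negPf /= zx /s_xy].
by rewrite !inE zx.
Qed.

Lemma natr_inj_pchar0 (R : idomainType) :
  has_pchar0 R -> injective (fun k : nat => k%:R : R).
Proof.
move=> /pcharf0P char0 i j; wlog le_ij : i j / (i <= j)%N => [IH | /eqP].
  by have [/IH // | /ltnW/IH IHji /esym/IHji] := leqP i j.
rewrite eq_sym -subr_eq0 -natrB // char0 subn_eq0 => le_ji.
by apply/eqP; rewrite eqn_leq le_ij.
Qed.

Lemma char_poly_eigenvalues01 (F : closedFieldType) (m k : nat)
    (A : 'M[F]_m) :
  has_pchar0 F -> subpred (eigenvalue A) (pred2 1 0) -> \tr A = k%:R ->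
  char_poly A = \prod_(a <- nseq k 1 ++ nseq (m - k) 0) ('X - a%:P).
Proof.
move=> char0 eig01 trA.
have [rs] := closed_field_poly_normal (char_poly A).
rewrite (monicP (char_poly_monic A)) scale1r => charA.
have /perm_nseq_pred2 perm_rs : {subset rs <= pred2 1 0}.
  move=> a a_rs; apply: eig01.
  by rewrite eigenvalue_root_char charA root_prod_XsubC.
suff count1 : count_mem 1 rs = k.
  by rewrite charA (perm_big _ perm_rs) /= count1 (size_char_poly_roots charA).
apply: (natr_inj_pchar0 char0).
rewrite /= -trA (mxtrace_sum_roots charA) (perm_big _ perm_rs) /=.
by rewrite big_cat /= !big_nseq !iter_addr_0 mul0rn addr0.
Qed.

Definition enum_mx (R : Type) (S : finType) (P : S -> S -> R) :
    'M[R]_#|{: S}| :=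
  \matrix_(a, b) P (enum_val a) (enum_val b).

Lemma mxtrace_enum_mx (R : nmodType) (S : finType) (P : S -> S -> R) :
  \tr (enum_mx P) = \sum_x P x x.
Proof.
rewrite /mxtrace (reindex enum_rank) /=; last exact/onW_bij/enum_rank_bij.
by apply: eq_bigr => x _; rewrite mxE enum_rankK.
Qed.

Lemma eigenvalue_enum_mx (F : fieldType) (S : finType) (P : S -> S -> F)
    (a : F) :
  eigenvalue (enum_mx P) a ->
  exists2 G : S -> F,
    exists x, G x != 0 & forall x, \sum_y P x y * G y = a * G x.
Proof.
rewrite -eigenvalue_tr => /eigenvalueP[v vP /rV0Pn[i vi_neq0]].
exists (fun x => v 0 (enum_rank x)).
  by exists (enum_val i); rewrite enum_valK.
move=> x; have /rowP/(_ (enum_rank x)) := vP; rewrite !mxE => <-.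
rewrite [RHS](reindex enum_rank) /=; last exact/onW_bij/enum_rank_bij.
by apply: eq_bigr => y _; rewrite !mxE !enum_rankK mulrC.
Qed.

Section PushCol.
Variables (X : Type) (m n : nat).
Implicit Types (c : 'cV[X]_m) (A B : 'M[X]_(m, n.+1)).

Definition push_col c A : 'M[X]_(m, n.+1) := row_mx c (col' ord_max A).

Lemma col0_push_col c A : col 0 (push_col c A) = c.
Proof.
apply/colP=> i; rewrite mxE -[RHS](row_mxEl c (col' ord_max A)).
by congr (row_mx _ _ i _); apply: val_inj.
Qed.

Definition const_cols c : 'M[X]_(m, n.+1) := \matrix_(i, j) c i 0.

Definition agree_cols k A B :=
  forall i (j : 'I_n.+1), (j < k)%N -> A i j = B i j.

Lemma agree_cols_full A B : agree_cols n.+1 A B <-> A = B.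
Proof.
by split=> [AB | -> //]; apply/matrixP=> i j; apply/AB/ltn_ord.
Qed.

Lemma agree_push_col k c A B :
  agree_cols k A B -> agree_cols k.+1 (push_col c A) (push_col c B).
Proof.
move=> AB i j; rewrite !mxE; case: (@split_ordP 1 n j) => // j' ->.
by rewrite !mxE ltnS => j'_lt; apply: AB; rewrite lift_max.
Qed.

Lemma push_const_cols c : push_col c (const_cols c) = const_cols c.
Proof.
apply/matrixP=> i j; rewrite !mxE.
by case: (@split_ordP 1 n j) => j' _; rewrite ?mxE ?ord1.
Qed.

Lemma push_col_fixed c A : push_col c A = A <-> A = const_cols c.
Proof.
split=> [fixA | ->]; last exact: push_const_cols.
suff agree_const k : agree_cols k A (const_cols c) by apply/agree_cols_full.
by elim: k => // k IHk; rewrite -fixA -push_const_cols; apply: agree_push_col.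
Qed.

End PushCol.

Section ShiftKernel.
Variables (R : nzSemiRingType) (X : finType) (m n : nat) (w : 'cV[X]_m -> R).

Definition shift_kernel (A N : 'M[X]_(m, n.+1)) : R :=
  \sum_(c | push_col c A == N) w c.

Lemma shift_kernelE A N :
  shift_kernel A N = if push_col (col 0 N) A == N then w (col 0 N) else 0.
Proof.
rewrite /shift_kernel; case: eqP => [pushN | not_pushN].
  rewrite (big_pred1 (col 0 N)) // => c /=.
  by apply/eqP/eqP => [<- | -> //]; rewrite col0_push_col.
rewrite big_pred0 // => c; apply/eqP=> pushN; apply: not_pushN.
by rewrite -pushN col0_push_col.
Qed.

Lemma sum_shift_kernel (G : 'M[X]_(m, n.+1) -> R) A :
  \sum_N shift_kernel A N * G N = \sum_c w c * G (push_col c A).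
Proof.
rewrite [RHS](partition_big (fun c => push_col c A) predT) //=.
by apply: eq_bigr => N _; rewrite mulr_suml; apply: eq_bigr => c /eqP ->.
Qed.

Lemma mxtrace_shift_kernel : \tr (enum_mx shift_kernel) = \sum_c w c.
Proof.
rewrite mxtrace_enum_mx.
rewrite [RHS](partition_big (fun c => const_cols n c) predT) //=.
apply: eq_bigr => A _; apply: eq_bigl => c.
by apply/eqP/eqP => [/push_col_fixed | <-] //; apply: push_const_cols.
Qed.

End ShiftKernel.

Lemma shift_kernel_eigenfun_const (F : idomainType) (X : finType) (m n : nat)
    (w : 'cV[X]_m -> F) (a : F) (G : 'M[X]_(m, n.+1) -> F) :
  a != 0 -> (forall A, \sum_N shift_kernel w A N * G N = a * G A) ->
  forall A B, G A = G B.
Proof.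
move=> a_neq0 eigG.
suff dep d k A B : (d + k = n.+1)%N -> agree_cols k A B -> G A = G B.
  by move=> A B; apply: (dep n.+1 0%N); rewrite ?addn0.
elim: d k A B => [|d IHd] k A B.
  by rewrite add0n => -> /agree_cols_full ->.
move=> dk AB; apply: (mulfI a_neq0); rewrite -!eigG !sum_shift_kernel.
apply: eq_bigr => c _; congr (_ * _).
by apply/(IHd k.+1)/agree_push_col; rewrite ?addnS.
Qed.

Lemma eigenvalue_shift_kernel01 (F : fieldType) (X : finType) (m n : nat)
    (w : 'cV[X]_m -> F) :
  \sum_c w c = 1 ->
  subpred (eigenvalue (enum_mx (shift_kernel (n := n) w))) (pred2 1 0).
Proof.
move=> w_sum1 a /eigenvalue_enum_mx[G [A GA_neq0] eigG] /=.
have [-> | a_neq0] := eqVneq a 0; first by rewrite orbT.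
rewrite orbF; apply/eqP/(mulIf GA_neq0); rewrite -eigG sum_shift_kernel.
under eq_bigr do rewrite (shift_kernel_eigenfun_const a_neq0 eigG _ A).
by rewrite -mulr_suml w_sum1.
Qed.

Lemma map_shift_kernel_mx (R S : nzSemiRingType) (f : {rmorphism R -> S})
    (X : finType) (m n : nat) (w : 'cV[X]_m -> R) :
  map_mx f (enum_mx (shift_kernel (n := n) w)) =
    enum_mx (shift_kernel (f \o w)).
Proof. by apply/matrixP=> a b; rewrite !mxE rmorph_sum. Qed.

Lemma char_poly_shift_kernel (F : closedFieldType) (X : finType) (m n : nat)
    (w : 'cV[X]_m -> F) :
  has_pchar0 F -> \sum_c w c = 1 ->
  char_poly (enum_mx (shift_kernel (n := n) w)) =
    \prod_(a <- 1 :: nseq (#|{: 'M[X]_(m, n.+1)}| - 1) 0) ('X - a%:P).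
Proof.
move=> char0 w_sum1; apply: (char_poly_eigenvalues01 (k := 1)) => //.
  exact: eigenvalue_shift_kernel01.
by rewrite mxtrace_shift_kernel.
Qed.

Definition col_prob (R : nzSemiRingType) (X : Type) (m : nat) (z : X -> R)
    (c : 'cV[X]_m) : R :=
  \prod_i z (c i 0).

Lemma sum_col_prob (R : comNzSemiRingType) (X : finType) (m : nat)
    (z : X -> R) :
  \sum_(c : 'cV[X]_m) col_prob z c = (\sum_x z x) ^+ m.
Proof.
rewrite -[m in RHS]card_ord -prodr_const bigA_distr_bigA /=.
rewrite (reindex (fun f : {ffun 'I_m -> X} => \col_i f i)) /=.
  by apply: eq_bigr => f _; apply: eq_bigr => i _; rewrite mxE.
exists (fun c : 'cV[X]_m => [ffun i => c i 0]) => [f _ | c _].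
  by apply/ffunP=> i; rewrite ffunE mxE.
by apply/colP=> i; rewrite mxE ffunE.
Qed.

Lemma shiftedE (n T : nat) (A N : dstate n.+1 T) :
  shifted A N = (push_col (col 0 N) A == N).
Proof.
apply/idP/eqP => [/forallP shiftAN | <-].
- apply/matrixP=> i j; rewrite mxE; case: (@split_ordP 1 n j) => j' -> {j}.
    by rewrite mxE ord1; congr (N i _); apply: val_inj.
  have /forallP/(_ (rshift 1 j'))/forallP/(_ (lift ord_max j'))/implyP :=
    shiftAN i.
  by move=> shiftN; rewrite mxE; apply/esym/eqP/shiftN; rewrite lift_max.
- apply/forallP=> i; apply/forallP=> j; apply/forallP=> l.
  rewrite mxE; case: (@split_ordP 1 n j) => j' -> {j}; first by rewrite ord1.
  apply/implyP=> /eqP[j'l]; rewrite mxE; apply/eqP; congr (A i _).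
  by apply: ord_inj; rewrite lift_max.
Qed.

Lemma trans_mxE (R : realType) (n T : nat) (hn : (1 <= n.+1)%N)
    (z : 'I_n.+2 -> R) :
  trans_mx T hn z = enum_mx (shift_kernel (col_prob z)).
Proof.
apply/matrixP=> a b; rewrite !mxE /trans_prob shiftedE shift_kernelE.
case: ifP => // _; apply: eq_bigr => i _; rewrite mxE.
by congr (z (_ i _)); apply: val_inj.
Qed.

Lemma char_poly_trans_mx (R : realType) (n T : nat) (hn : (1 <= n.+1)%N)
    (z : 'I_n.+2 -> R) :
  \sum_x z x = 1 ->
  char_poly (map_mx (real_complex R) (trans_mx T hn z)) =
    \prod_(a <- 1 :: nseq (n.+2 ^ (n.+1 * (T - 1)) - 1) 0) ('X - a%:P).
Proof.
move=> z_sum1; rewrite trans_mxE map_shift_kernel_mx char_poly_shift_kernel.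
- by rewrite card_mx card_ord mulnC.
- exact: pchar_num.
- by rewrite -rmorph_sum sum_col_prob z_sum1 expr1n rmorph1.
Qed.

Theorem theorem3p13 (R : realType) (n T : nat) (hn : (1 <= n)%N)
    (hT : (2 <= T)%N) (z : 'I_n.+1 -> R)
    (z_ge0 : forall i, 0 <= z i) (z_sum1 : \sum_(i < n.+1) z i = 1) :
  let M := map_mx (real_complex R) (trans_mx T hn z) in
  [/\ forall a : complex R, eigenvalue M a <-> a = 1 \/ a = 0,
      alg_mult M 1 = 1%N
    & alg_mult M 0 = ((n.+1 ^ (n * (T - 1))) - 1)%N].
Proof.
case: n hn z z_ge0 z_sum1 => // n hn z _ z_sum1 M.
have charM := char_poly_trans_mx T hn z_sum1.
have mult0_gt0 : (0 < n.+2 ^ (n.+1 * (T - 1)) - 1)%N.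
  rewrite subn_gt0 -[ltnLHS](exp1n (n.+1 * (T - 1))).
  by rewrite ltn_exp2r // muln_gt0 subn_gt0.
split; rewrite /alg_mult ?charM ?mu_prod_XsubC /=.
- move=> a; rewrite eigenvalue_root_char charM root_prod_XsubC.
  rewrite inE mem_nseq mult0_gt0 /=.
  by split=> [/pred2P // | [] ->]; rewrite eqxx ?orbT.
- by rewrite eqxx count_nseq /= eq_sym oner_eq0 mul0n.
- by rewrite count_nseq /= eqxx oner_eq0 mul1n.
Qed.
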